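(* There is an absolute constant $C>0$ such that the following holds. Let $N=2^n$ be a power of two, let ${\cal H}$ be the discrete bivariate Haar transform on $\mathbb{C}^{N\times N}$, and let ${\cal A}:\mathbb{C}^{N\times N}\to\mathbb{C}^m$ be a linear map such that ${\cal A}{\cal H}^{-1}:\mathbb{C}^{N\times N}\to\mathbb{C}^m$ has the restricted isometry property of order $Cs\log^3(N)$ and level $\delta<1/3$. Then for any $\mathbf{X}\in\mathbb{C}^{N\times N}$, if noisy measurements $\mathbf{y}={\cal A}(\mathbf{X})+\boldsymbol{\xi}$ are observed with $\|\boldsymbol{\xi}\|_2\le\varepsilon$, then $$\hat{\mathbf{X}} = \operatorname{argmin}_{\mathbf{Z}}\|\mathbf{Z}\|_{TV}\quad\text{such that}\quad\|{\cal A}(\mathbf{Z})-\mathbf{y}\|_2\le\varepsilon$$ satisfies $$\|\mathbf{X}-\hat{\mathbf{X}}\|_2\lesssim\frac{\|\nabla\mathbf{X}-(\nabla\mathbf{X})_s\|_1}{\sqrt{s}}+\varepsilon.$$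
   Context: Notation: $u\lesssim v$ means $u\le C'v$ for an absolute constant $C'>0$. $\|\cdot\|_p$ is the entrywise $\ell_p$ norm of an array; inner product $\langle\mathbf{X},\mathbf{Y}\rangle=\mathrm{tr}(\mathbf{X}\mathbf{Y}^* )$. A linear map ${\cal A}$ from arrays to $\mathbb{C}^m$ has the restricted isometry property of order $s$ and level $\delta$ if $(1-\delta)\|\mathbf{X}\|_2^2\le\|{\cal A}(\mathbf{X})\|_2^2\le(1+\delta)\|\mathbf{X}\|_2^2$ for all arrays with at most $s$ nonzero entries. Discrete gradient: $(\mathbf{X}_x)_{j,k}=X_{j+1,k}-X_{j,k}$, $(\mathbf{X}_y)_{j,k}=X_{j,k+1}-X_{j,k}$; $\nabla\mathbf{X}\in\mathbb{C}^{N\times N\times2}$ with $[\nabla\mathbf{X}]_{j,k}=((\mathbf{X}_x)_{j,k},(\mathbf{X}_y)_{j,k})$, an undefined component being set to $0$ (first component when $j=N$, second when $k=N$). $\|\mathbf{X}\|_{TV}=\|\nabla\mathbf{X}\|_1$. $(\nabla\mathbf{X})_s$ is the best $s$-sparse approximation of $\nabla\mathbf{X}$ (its $s$ largest-magnitude entries). Haar transform: $H^0=\mathbf{1}_{[0,1)}$, $H^1=\mathbf{1}_{[0,1/2)}-\mathbf{1}_{[1/2,1)}$; for $e=(e_1,e_2)\in\{(0,1),(1,0),(1,1)\}$, $H^e(u,v)=H^{e_1}(u)H^{e_2}(v)$, $H^e_{j,k}(x)=2^jH^e(2^jx-k)$, $j\ge0$, $k\in\mathbb{Z}^2\cap2^j[0,1)^2$.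 Identifying $\mathbf{X}\in\mathbb{C}^{N\times N}$ with the function equal to $NX_{j,k}$ on $[\frac{j-1}{N},\frac jN)\times[\frac{k-1}{N},\frac kN)$, the constant function and $\{H^e_{j,k}:j\le n-1\}$ give an orthonormal basis $\{\mathbf{h}\}$ of $\mathbb{C}^{N\times N}$; ${\cal H}(\mathbf{X})$ is the $N\times N$ array of coefficients $\langle\mathbf{X},\mathbf{h}\rangle$. *)

(* Defs.v *)
(* R : realType, complex numbers C := R[i] (mathcomp-real-closed). *)
From HB Require Import structures.
From mathcomp Require Import all_boot all_order all_algebra.
From mathcomp Require Import reals exp.
From mathcomp Require Export complex.
Set Implicit Arguments. Unset Strict Implicit. Unset Printing Implicit Defensive.
Import Order.TTheory GRing.Theory Num.Theory.
Local Open Scope ring_scope.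

Section Defs.
Variable R : realType.
Local Notation C := R[i].

(* modulus of a complex number *)
Definition cabs (z : C) : R := Normc.normc z.

(* entrywise l1 / l2 norms of an array indexed by a finite type *)
Definition l1norm (I : finType) (x : I -> C) : R := \sum_i cabs (x i).
Definition l2norm (I : finType) (x : I -> C) : R :=
  Num.sqrt (\sum_i cabs (x i) ^+ 2).

Definition mnorm2 (N : nat) (X : 'M[C]_N) : R :=
  l2norm (fun ij : 'I_N * 'I_N => X ij.1 ij.2).
Definition vnorm2 (m : nat) (y : 'cV[C]_m) : R :=
  l2norm (fun i : 'I_m => y i 0).

(* number of nonzero entries *)
Definition nnz (N : nat) (X : 'M[C]_N) : nat :=
  #|[set ij : 'I_N * 'I_N | X ij.1 ij.2 != 0]|.

(* restricted isometry property of order s (a real number) and level delta *)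
Definition RIP (N m : nat) (F : 'M[C]_N -> 'cV[C]_m) (s delta : R) : Prop :=
  forall X : 'M[C]_N, (nnz X)%:R <= s ->
    (1 - delta) * mnorm2 X ^+ 2 <= vnorm2 (F X) ^+ 2 /\
    vnorm2 (F X) ^+ 2 <= (1 + delta) * mnorm2 X ^+ 2.

(* discrete gradient: index (j, k, c), c = 0 : x-component, c = 1 : y-component;
   undefined components are set to 0 *)
Definition grad (N : nat) (X : 'M[C]_N) : 'I_N * 'I_N * 'I_2 -> C :=
  fun '(j, k, c) =>
    if c == 0 :> 'I_2 then
      (if insub (j.+1) is Some j' then X j' k - X j k else 0)
    else
      (if insub (k.+1) is Some k' then X j k' - X j k else 0).

Definition TV (N : nat) (X : 'M[C]_N) : R := l1norm (grad X).

(* T is the support of a best s-sparse approximation of v: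
   T consists of min(s, #entries) entries of largest magnitude *)
Definition is_best_support (I : finType) (s : nat) (v : I -> C) (T : {set I}) : Prop :=
  #|T| = minn s #|I| /\
  forall i j, i \in T -> j \notin T -> cabs (v j) <= cabs (v i).

(* the best s-sparse approximation (v)_s supported on T *)
Definition sparse_part (I : finType) (v : I -> C) (T : {set I}) : I -> C :=
  fun i => if i \in T then v i else 0.

(* Haar functions on [0,1) *)
Definition ind01 (a b t : R) : R := if (a <= t) && (t < b) then 1 else 0.
Definition H0 (t : R) : R := ind01 0 1 t.
Definition H1 (t : R) : R := ind01 0 (1/2) t - ind01 (1/2) 1 t.
Definition He (e : bool) : R -> R := if e then H1 else H0.

(* H^e_{j,k}(x1,x2) = 2^j H^{e1}(2^j x1 - k1) H^{e2}(2^j x2 - k2) *)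
Definition haar_fun (j : nat) (e1 e2 : bool) (k1 k2 : nat) (x1 x2 : R) : R :=
  2 ^+ j * He e1 (2 ^+ j * x1 - k1%:R) * He e2 (2 ^+ j * x2 - k2%:R).

(* Value of the (p,q)-th basis function of [0,1)^2, N = 2^n.
   Layout: (0,0) is the constant function; otherwise, with
   j = floor(log2 (max p q)), e1 = (2^j <= p), e2 = (2^j <= q),
   k1 = p - e1 2^j, k2 = q - e2 2^j, it is H^{(e1,e2)}_{j,(k1,k2)}.
   This is a bijection between 'I_N * 'I_N and {constant} U {(e,j,k) : j <= n-1}. *)
Definition haar_val (n : nat) (p q : nat) (x1 x2 : R) : R :=
  if maxn p q == 0%N then 1 else
  let j := trunc_log 2 (maxn p q) in
  let e1 := (2 ^ j <= p)%N in
  let e2 := (2 ^ j <= q)%N in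
  haar_fun j e1 e2 (p - e1 * 2 ^ j) (q - e2 * 2 ^ j) x1 x2.

(* The basis element as an N x N array: a function f equal to N X_{a,b} on the
   cell [a/N,(a+1)/N) x [b/N,(b+1)/N) (0-indexed) corresponds to X_{a,b} = f/N;
   f is constant on each cell, we evaluate it at the cell's midpoint. *)
Definition haar_atom (n : nat) (p q : 'I_(2 ^ n)) : 'M[C]_(2 ^ n) :=
  \matrix_(a, b)
    ((haar_val n p q ((a%:R + 1/2) / (2 ^ n)%:R) ((b%:R + 1/2) / (2 ^ n)%:R)
      / (2 ^ n)%:R)%:C)%C.

(* inner product <X, Y> = trace of X times conjugate-transpose of Y *)
Definition minner (N : nat) (X Y : 'M[C]_N) : C :=
  \sum_a \sum_b X a b * ((Y a b)^*)%C.

(* discrete bivariate Haar transform H(X) *)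
Definition haar (n : nat) (X : 'M[C]_(2 ^ n)) : 'M[C]_(2 ^ n) :=
  \matrix_(p, q) minner X (haar_atom p q).

(* its inverse (synthesis with the orthonormal Haar basis) *)
Definition haar_inv (n : nat) (c : 'M[C]_(2 ^ n)) : 'M[C]_(2 ^ n) :=
  \sum_p \sum_q c p q *: haar_atom p q.

(* Xhat is a solution of  argmin ||Z||_TV  s.t.  ||A Z - y||_2 <= eps *)
Definition is_TV_min (N m : nat) (A : 'M[C]_N -> 'cV[C]_m) (y : 'cV[C]_m)
  (eps : R) (Xhat : 'M[C]_N) : Prop :=
  vnorm2 (A Xhat - y) <= eps /\
  forall Z : 'M[C]_N, vnorm2 (A Z - y) <= eps -> TV Xhat <= TV Z.

End Defs.

(* Main.v *)
(* By the two-dimensional discrete Poincare inequality, each Haar coefficient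
   other than the constant one is bounded by the total variation over the
   support of its wavelet, and a pixel lies in at most [4 * n] supports. Hence
   the l1 norm of the Haar details of an image is at most [4 * n] times its total
   variation, so RIP of order [t + 1] on Haar coefficients bounds the l2 norm
   by the measurements plus [n * TV / sqrt t]. The error [D] of a minimizer of
   the total variation lies in a cone on which [TV D] is at most [sqrt s] times
   its l2 norm, up to the best s-term error of the gradient. Taking [t] of order
   [s * n ^ 2], within the available [s * n ^ 3], absorbs the resulting multiple
   of the l2 norm of [D]. *)
Require Import Defs.
From HB Require Import structures.
From mathcomp Require Import all_boot all_order all_algebra.
From mathcomp Require Import reals exp.
From mathcomp Require Import complex.
From mathcomp Require Import zify ring lra.
Import Order.TTheory GRing.Theory Num.Theory.
Local Open Scope ring_scope.

Set Implicit Arguments.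
Unset Strict Implicit.
Unset Printing Implicit Defensive.

(** * Norms of complex arrays *)

Section Norms.
Variables (R : realType) (I : finType).
Local Notation C := R[i].

Lemma cabs_ge0 (z : C) : 0 <= cabs z.
Proof. by case: z => a b; rewrite /cabs /= sqrtr_ge0. Qed.

Lemma cabs0 : cabs (0 : C) = 0.
Proof. exact: Normc.normc0. Qed.

Lemma cabs_eq0 (z : C) : (cabs z == 0) = (z == 0).
Proof.
apply/eqP/eqP => [/Normc.eq0_normc //|->]; exact: cabs0.
Qed.

Lemma ler_cabsD (x y : C) : cabs (x + y) <= cabs x + cabs y.
Proof. exact: le_normcD. Qed.

Lemma cabsN (x : C) : cabs (- x) = cabs x.
Proof. exact: normcN. Qed.

Lemma ler_cabsB (x y : C) : cabs (x - y) <= cabs x + cabs y.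
Proof. by rewrite -(cabsN y) ler_cabsD. Qed.

Lemma cabsM (x y : C) : cabs (x * y) = cabs x * cabs y.
Proof. exact: Normc.normcM. Qed.

Lemma cabs_real (x : R) : cabs (x%:C)%C = `|x|.
Proof. by rewrite /cabs /= expr0n /= addr0 sqrtr_sqr. Qed.

Lemma sqr_cabs (z : C) : ((cabs z ^+ 2)%:C)%C = z * (z^*)%C.
Proof. by rewrite -sqr_normc -rmorphXn. Qed.

Lemma ler_cabs_sum (J : Type) (r : seq J) (P : pred J) (f : J -> C) :
  cabs (\sum_(i <- r | P i) f i) <= \sum_(i <- r | P i) cabs (f i).
Proof.
elim/big_rec2: _ => [|i y x _ h]; first by rewrite cabs0.
by apply: le_trans (ler_cabsD _ _) _; rewrite lerD2l.
Qed.

(** After dividing by the two norms, [x * y <= (x ^+ 2 + y ^+ 2) / 2] is summed termwise; a zero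
    norm is treated apart. *)
Lemma cauchy_schwarz_sum (a b : I -> R) :
  \sum_i a i * b i <= Num.sqrt (\sum_i a i ^+ 2) * Num.sqrt (\sum_i b i ^+ 2).
Proof.
have sq (c : I -> R) : 0 <= \sum_i c i ^+ 2 by apply: sumr_ge0 => i _; apply: sqr_ge0.
have null (c d : I -> R) : \sum_i c i ^+ 2 = 0 -> \sum_i c i * d i = 0.
  move=> /psumr_eq0P c0; apply: big1 => i _.
  by have /eqP := c0 (fun j _ => sqr_ge0 _) i isT; rewrite sqrf_eq0 => /eqP ->; rewrite mul0r.
have [a0|a0] := eqVneq (\sum_i a i ^+ 2) 0.
  by rewrite (null a b a0) a0 sqrtr0 mul0r.
have [b0|b0] := eqVneq (\sum_i b i ^+ 2) 0.
  under eq_bigr do rewrite mulrC.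
  by rewrite (null b a b0) b0 sqrtr0 mulr0.
set A := Num.sqrt _; set B := Num.sqrt _.
have A0 : 0 < A by rewrite sqrtr_gt0 lt_neqAle eq_sym a0 sq.
have B0 : 0 < B by rewrite sqrtr_gt0 lt_neqAle eq_sym b0 sq.
have -> : \sum_i a i * b i = A * B * \sum_i (a i / A) * (b i / B).
  by rewrite mulr_sumr; apply: eq_bigr => i _; field; rewrite !gt_eqF.
rewrite -[leRHS]mulr1 ler_wpM2l ?mulr_ge0 ?sqrtr_ge0//.
have <- : \sum_i ((a i / A) ^+ 2 + (b i / B) ^+ 2) / 2 = 1 :> R.
  rewrite -mulr_suml big_split /=.
  under eq_bigr do rewrite expr_div_n.
  under [X in _ + X]eq_bigr do rewrite expr_div_n.
  by rewrite -!mulr_suml /A /B !sqr_sqrtr ?sq// !divff//; lra.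
apply: ler_sum => i _.
by have := sqr_ge0 (a i / A - b i / B); lra.
Qed.

Lemma sqr_l2norm (x : I -> C) : l2norm x ^+ 2 = \sum_i cabs (x i) ^+ 2.
Proof. by rewrite sqr_sqrtr// sumr_ge0// => i _; apply: sqr_ge0. Qed.

Lemma l2norm_ge0 (x : I -> C) : 0 <= l2norm x.
Proof. exact: sqrtr_ge0. Qed.

Lemma eq_l2norm (x y : I -> C) : x =1 y -> l2norm x = l2norm y.
Proof. by move=> xy; congr Num.sqrt; apply: eq_bigr => i _; rewrite xy. Qed.

Lemma l2normN (x : I -> C) : l2norm (fun i => - x i) = l2norm x.
Proof. by congr Num.sqrt; apply: eq_bigr => i _; rewrite cabsN. Qed.

Lemma ler_l2norm (x : I -> C) (c : R) :
  0 <= c -> \sum_i cabs (x i) ^+ 2 <= c ^+ 2 -> l2norm x <= c.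
Proof.
by move=> c0 h; rewrite -(@ler_pXn2r _ 2) ?nnegrE ?l2norm_ge0// sqr_l2norm.
Qed.

Lemma ler_l2normD (x y : I -> C) :
  l2norm (fun i => x i + y i) <= l2norm x + l2norm y.
Proof.
apply: ler_l2norm; first by rewrite addr_ge0 ?l2norm_ge0.
rewrite sqrrD !sqr_l2norm mulr2n.
have cs := cauchy_schwarz_sum (fun i => cabs (x i)) (fun i => cabs (y i)).
apply: (@le_trans _ _ (\sum_i (cabs (x i) + cabs (y i)) ^+ 2)).
  by apply: ler_sum => i _; rewrite lerXn2r ?nnegrE ?addr_ge0 ?cabs_ge0// ler_cabsD.
under eq_bigr do rewrite sqrrD mulr2n.
by rewrite !big_split /= /l2norm lerD2r lerD2l lerD.
Qed.

Lemma l1norm_ge0 (x : I -> C) : 0 <= l1norm x.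
Proof. by apply: sumr_ge0 => i _; apply: cabs_ge0. Qed.

Lemma l1_le_sqrt_card_l2 (S : {set I}) (x : I -> C) :
  \sum_(i in S) cabs (x i) <= Num.sqrt #|S|%:R * l2norm x.
Proof.
have -> : \sum_(i in S) cabs (x i) = \sum_i (i \in S)%:R * cabs (x i).
  by rewrite big_mkcond; apply: eq_bigr => i _; case: ifP; rewrite ?mul1r ?mul0r.
apply: le_trans (cauchy_schwarz_sum _ _) _; rewrite le_eqVlt; apply/orP; left; apply/eqP.
congr (Num.sqrt _ * _); rewrite -sum1_card natr_sum [RHS]big_mkcond /=.
by apply: eq_bigr => i _; case: ifP; rewrite ?expr1n ?expr0n.
Qed.

End Norms.

#[local] Arguments cabs {R} _ : simpl never.

(** * Sparse recovery from the restricted isometry property *)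

Section SparseRecovery.
Variables (R : realType) (I : finType).
Local Notation C := R[i].
Implicit Types (x : {ffun I -> C}) (t : nat).

Definition supp x : {set I} := [set i | x i != 0].

Definition restr (S : {set I}) x : {ffun I -> C} :=
  [ffun i => if i \in S then x i else 0].

Lemma restrD S x : restr S x + restr (~: S) x = x.
Proof.
apply/ffunP => i; rewrite !ffunE in_setC; case: (i \in S); rewrite ?addr0 ?add0r//.
Qed.

Lemma supp_restr S x : supp (restr S x) \subset S.
Proof. by apply/subsetP => i; rewrite inE ffunE; case: ifP => //; rewrite eqxx. Qed.

Lemma l1norm_restr S x : l1norm (restr S x) = \sum_(i in S) cabs (x i).
Proof.
by rewrite /l1norm [RHS]big_mkcond; apply: eq_bigr => i _; rewrite ffunE; case: ifP; rewrite ?cabs0.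
Qed.

(** Greedy choice: each step adds a maximizer over the complement. *)
Lemma top_entries (f : I -> R) t : (t <= #|I|)%N ->
  exists2 S : {set I}, #|S| = t & forall i j, i \in S -> j \notin S -> f j <= f i.
Proof.
elim: t => [|t IH] tI; first by exists set0; rewrite ?cards0// => i j; rewrite inE.
have [S St Stop] := IH (ltnW tI).
have [k0 k0S] : exists k, k \notin S.
  apply/existsP; rewrite -negb_forall; apply: contraTN tI => /forallP /= h.
  rewrite -ltnNge ltnS -St.
  by apply/subset_leq_card/subsetP => i _.
case: (@Order.TotalTheory.arg_maxP _ _ I k0 (fun k => k \notin S) f k0S) => k kS kmax.
exists (k |: S); first by rewrite cardsU1 kS St.
move=> i j; rewrite !inE negb_or => /orP[/eqP->|iS] /andP[jk jS]; first exact: kmax.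
exact: Stop.
Qed.

Lemma ler_l2norm_supp t x (M : R) : (#|supp x| <= t)%N -> 0 <= M ->
  (forall i, cabs (x i) <= M) -> l2norm x <= Num.sqrt t%:R * M.
Proof.
move=> xt M0 xM; apply: ler_l2norm; first by rewrite mulr_ge0 ?sqrtr_ge0.
rewrite exprMn sqr_sqrtr ?ler0n//.
apply: (@le_trans _ _ (\sum_(i in supp x) M ^+ 2)).
  rewrite [leRHS]big_mkcond /=; apply: ler_sum => i _; rewrite inE; case: eqP => [->|_] /=.
    by rewrite cabs0 expr0n.
  by rewrite lerXn2r ?nnegrE ?cabs_ge0.
by rewrite sumr_const -[leLHS]mulr_natl ler_wpM2r ?sqr_ge0// ler_nat.
Qed.

(** [F] abstracts the norm of the measurements of a coefficient array. The lower bound is asked at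
    [t.+1] to leave room for one coordinate outside the l1 bound, namely the constant Haar
    coefficient. *)
Variables (F : {ffun I -> C} -> R) (t : nat).
Hypothesis t0 : (0 < t)%N.
Hypothesis F_subadd : forall x y, F (x + y) <= F x + F y.
Hypothesis F_le : forall x, (#|supp x| <= t)%N -> F x <= 2 * l2norm x.
Hypothesis F_ge : forall x, (#|supp x| <= t.+1)%N -> l2norm x <= 2 * F x.

(* Peel off blocks of [t] largest entries: each block is bounded by the
   smallest entry of the previous one, hence by its mean. *)
Lemma bounded_seminorm_le x (M : R) : 0 <= M -> (forall i, cabs (x i) <= M) ->
  F x <= 2 * (Num.sqrt t%:R * M + l1norm x / Num.sqrt t%:R).
Proof.
have st : 0 < Num.sqrt t%:R :> R by rewrite sqrtr_gt0 ltr0n.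
have [k] := ubnP #|supp x|; elim: k x M => // k IH x M xk M0 xM.
have [xt|tx] := leqP #|supp x| t.
  apply: le_trans (F_le xt) _; rewrite ler_pM2l ?ltr0n//.
  apply: le_trans (ler_l2norm_supp xt M0 xM) _.
  by rewrite lerDl divr_ge0 ?l1norm_ge0 ?sqrtr_ge0.
have [S St Stop] := top_entries (fun i => cabs (x i)) (leq_trans (ltnW tx) (max_card _)).
have [i0 i0S] : exists i, i \in S by apply/set0Pn; rewrite -card_gt0 St.
case: (@Order.TotalTheory.arg_minP _ _ I i0 (fun k => k \in S) (fun i => cabs (x i)) i0S)
  => k1 k1S kmin.
pose m := cabs (x k1).
have m0 : 0 <= m by apply: cabs_ge0.
have hi : F (restr S x) <= 2 * (Num.sqrt t%:R * M).
  have sS : (#|supp (restr S x)| <= t)%N by rewrite -St subset_leq_card ?supp_restr.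
  apply: le_trans (F_le sS) _; rewrite ler_pM2l ?ltr0n//.
  apply: ler_l2norm_supp => // i; rewrite ffunE; case: ifP => // _; by rewrite cabs0.
have lo : F (restr (~: S) x) <=
    2 * (Num.sqrt t%:R * m + l1norm (restr (~: S) x) / Num.sqrt t%:R).
  apply: IH => // [|i]; last first.
    by rewrite ffunE in_setC; case: ifP => [iS|_]; rewrite ?cabs0//; apply: Stop.
  have -> : supp (restr (~: S) x) = supp x :\: S.
    apply/setP => i; rewrite !inE ffunE in_setC.
    by case: (i \in S); rewrite /= ?eqxx.
  (* A zero among the [t] largest entries would put the whole support inside [S]. Hence removing [S]
     strictly shrinks the support and the induction proceeds. *)
  have Sx : S \subset supp x.
    apply/subsetP => i iS; rewrite inE; apply/negP => /eqP xi0.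
    have : (#|supp x| <= t)%N.
      rewrite -St; apply/subset_leq_card/subsetP => j; rewrite inE => xj.
      apply: contraNT xj => jS; rewrite -cabs_eq0 eq_le cabs_ge0 andbT.
      by have := Stop _ _ iS jS; rewrite xi0 cabs0.
    by rewrite leqNgt tx.
  by rewrite cardsDS// St; lia.
have mS : Num.sqrt t%:R * m <= l1norm (restr S x) / Num.sqrt t%:R.
  rewrite ler_pdivlMr// mulrAC -expr2 sqr_sqrtr ?ler0n// l1norm_restr.
  by rewrite -St mulr_natl -sumr_const; apply: ler_sum => i; apply: kmin.
rewrite -{1}(restrD S x); apply: le_trans (F_subadd _ _) _.
apply: le_trans (lerD hi lo) _.
have -> : l1norm x = l1norm (restr S x) + l1norm (restr (~: S) x).
  rewrite !l1norm_restr [LHS](bigID (mem S)) /=; congr (_ + _).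
  by apply: eq_bigl => i; rewrite in_setC.
rewrite mulrDl; lra.
Qed.

(** Threshold at [M = L / t]. The part [h] on [i0] and the entries above [M] is [t.+1]-sparse, so
    [F_ge] applies. The rest [r] is bounded by [M] and has l1 norm at most [L], so [F] of it is at
    most [4 * L / sqrt t] and its l2 norm at most [L / sqrt t]; whence [9 = 2 * 4 + 1]. *)
Lemma sparse_recovery (i0 : I) x :
  l2norm x <= 2 * F x + 9 * (\sum_(i | i != i0) cabs (x i)) / Num.sqrt t%:R.
Proof.
set L := \sum_(i | _) _.
have L0 : 0 <= L by apply: sumr_ge0 => i _; apply: cabs_ge0.
have st : 0 < Num.sqrt t%:R :> R by rewrite sqrtr_gt0 ltr0n.
have tR : 0 < t%:R :> R by rewrite ltr0n.
pose M := L / t%:R.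
have M0 : 0 <= M by rewrite divr_ge0 ?(ltW tR).
pose B := [set i | (i != i0) && (M < cabs (x i))].
pose S := i0 |: B.
(* Markov's inequality: the entries exceeding [M] sum to at most [L = t * M]. *)
have Bt : (#|B| <= t)%N.
  have [->|/set0Pn[k kB]] := eqVneq B set0; first by rewrite cards0.
  have BL : \sum_(i in B) M < L.
    rewrite /L [ltRHS](bigID (mem B)) /=; apply: ltr_wpDr; first by apply: sumr_ge0 => *; apply: cabs_ge0.
    have -> : \sum_(i | (i != i0) && (i \in B)) cabs (x i) = \sum_(i in B) cabs (x i).
      by apply: eq_bigl => i; rewrite inE; case: (i != i0).
    apply: ltr_sum; first by apply/hasP; exists k; rewrite ?mem_index_enum.
    by move=> i; rewrite inE => /andP[].
  rewrite sumr_const -[ltLHS]mulr_natl in BL.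
  have Mt : t%:R * M = L by rewrite mulrC divfK ?gt_eqF.
  have Mp : 0 < M by rewrite divr_gt0// (le_lt_trans _ BL)// mulr_ge0 ?ler0n.
  by move: BL; rewrite -Mt ltr_pM2r// ltr_nat => /ltnW.
set h := restr S x; set r := restr (~: S) x.
have r_le i : cabs (r i) <= M.
  rewrite ffunE !inE; case: ifP; rewrite ?cabs0//.
  by rewrite negb_or negb_and negbK => /andP[/negbTE->] /=; rewrite -leNgt.
have rL : l1norm r <= L.
  rewrite l1norm_restr /L [leRHS]big_mkcond [leLHS]big_mkcond; apply: ler_sum => i _ /=.
  by rewrite !inE; case: eqP => //= _; case: ifP; rewrite // cabs_ge0.
have stM : Num.sqrt t%:R * M = L / Num.sqrt t%:R.
  rewrite /M -{2}[t%:R](@sqr_sqrtr R) ?ler0n//.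
  by field; rewrite gt_eqF.
(* Stated for every array with the moduli of [r] so as to cover [- r]. *)
have rF (y : {ffun I -> C}) : (forall i, cabs (y i) = cabs (r i)) -> F y <= 4 * (L / Num.sqrt t%:R).
  move=> yr; apply: le_trans (bounded_seminorm_le M0 _) _ => [i|]; first by rewrite yr.
  have -> : l1norm y = l1norm r by apply: eq_bigr => i _.
  have : l1norm r / Num.sqrt t%:R <= L / Num.sqrt t%:R by rewrite ler_pM2r// invr_gt0.
  by rewrite stM; lra.
have hx : h = x + - r by rewrite -[X in X - _](restrD S x) addrK.
have hF : F h <= F x + 4 * (L / Num.sqrt t%:R).
  rewrite hx; apply: le_trans (F_subadd _ _) _; rewrite lerD2l; apply: rF => i.
  by rewrite ffunE cabsN.
have h2 : l2norm h <= 2 * F h.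
  apply: F_ge; apply: leq_trans (subset_leq_card (supp_restr _ _)) _.
  by rewrite cardsU1; case: (_ \notin _) => //; lia.
have r2 : l2norm r <= L / Num.sqrt t%:R.
  apply: ler_l2norm; first by rewrite divr_ge0 ?sqrtr_ge0.
  rewrite expr_div_n sqr_sqrtr ?ler0n// expr2 -mulrA -/M.
  apply: (@le_trans _ _ (\sum_i cabs (r i) * M)).
    by apply: ler_sum => i _; rewrite expr2 ler_wpM2l ?cabs_ge0.
  by rewrite -mulr_suml ler_wpM2r.
have -> : l2norm x = l2norm (fun i => h i + r i).
  by apply: eq_l2norm => i; rewrite -{1}(restrD S x) ffunE.
apply: le_trans (ler_l2normD _ _) _.
apply: le_trans (lerD h2 r2) _.
rewrite -mulrA; lra.
Qed.

End SparseRecovery.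

(** * Orthonormality of the Haar basis *)

(** A one-sided inverse of a square matrix is two-sided, so orthonormal rows give orthonormal
    columns. *)
Lemma orthogonal_tr (F : comPzRingType) (I : finType) (u : I -> I -> F) :
  (forall i j, \sum_k u i k * u j k = (i == j)%:R) ->
  forall i j, \sum_k u k i * u k j = (i == j)%:R.
Proof.
move=> uu i j.
pose U := \matrix_(a < #|I|, b < #|I|) u (enum_val a) (enum_val b).
have sumE (G : I -> F) : \sum_(a < #|I|) G (enum_val a) = \sum_k G k.
  by rewrite -(big_enum_val (A := I)).
have delta a b : (enum_val a == enum_val b :> I) = (a == b :> 'I_#|I|).
  by rewrite (inj_eq enum_val_inj).
have UUt : U *m U^T = 1%:M.
  apply/matrixP => a b; rewrite !mxE -delta -uu -sumE.
  by apply: eq_bigr => k _; rewrite !mxE.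
have /matrixP/(_ (enum_rank i) (enum_rank j)) := mulmx1C UUt.
rewrite !mxE -delta !enum_rankK => <-; rewrite -sumE.
by apply: eq_bigr => k _; rewrite !mxE !enum_rankK.
Qed.

Lemma divn_block (M a k : nat) : (0 < M)%N ->
  (a %/ M == k)%N = (k * M <= a < k.+1 * M)%N.
Proof. by move=> M0; rewrite eqn_leq andbC leq_divRL// -[X in _ && X]ltnS ltn_divLR. Qed.

(** * One-dimensional Haar functions on the integers *)

Section Wavelet.
Variable R : realType.
Local Notation C := R[i].

(* Restriction to the integers of a one-dimensional Haar function supported on
   the [k]-th block of length [2 ^ l.+1]: the indicator of the block ([e = false]),
   or plus and minus one on its halves ([e = true]). *)
Definition wav (l : nat) (e : bool) (k a : nat) : R :=
  (a %/ 2 ^ l.+1 == k)%N%:R * (-1) ^+ (e && odd (a %/ 2 ^ l)).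

(** The midpoint [a + 1/2] never meets an endpoint, so real comparisons become integer ones. Here
    [p] and [q] count half-blocks. *)
Lemma ind01_mid (l k a p q : nat) :
  ind01 (p%:R / 2) (q%:R / 2) ((a%:R + 1 / 2) / (2 ^ l.+1)%:R - k%:R) =
  (((2 * k + p) * 2 ^ l <= a < (2 * k + q) * 2 ^ l)%N)%:R :> R.
Proof.
have M0 : 0 < (2 ^ l)%:R :> R by rewrite ltr0n expn_gt0.
have D (c : nat) : c%:R / 2 + k%:R = ((2 * k + c) * 2 ^ l)%:R / (2 ^ l.+1)%:R :> R.
  rewrite expnS !natrM natrD natrM; field; rewrite gt_eqF//.
rewrite /ind01 lerBrDr ltrBlDr !D ler_pM2r ?invr_gt0 ?ltr0n ?expn_gt0//.
rewrite ltr_pM2r ?invr_gt0 ?ltr0n ?expn_gt0//.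
have -> (x : nat) : (x%:R <= a%:R + 1 / 2 :> R) = (x <= a)%N.
  apply/idP/idP => [|xa]; last by rewrite (@le_trans _ _ a%:R) ?ler_nat// lerDl; lra.
  apply: contraTT; rewrite -!ltNge -ltnNge => ax.
  have : a.+1%:R <= x%:R :> R by rewrite ler_nat.
  by rewrite -natr1; lra.
have -> (x : nat) : (a%:R + 1 / 2 < x%:R :> R) = (a < x)%N.
  apply/idP/idP => [|xa]; last first.
    have : a.+1%:R <= x%:R :> R by rewrite ler_nat.
    by rewrite -natr1; lra.
  apply: contraTT; rewrite -!leNgt -leqNgt => ax.
  by rewrite (@le_trans _ _ a%:R) ?ler_nat// lerDl; lra.
by case: ifP.
Qed.

Lemma He_wav (l k a : nat) (e : bool) :
  He e ((a%:R + 1 / 2) / (2 ^ l.+1)%:R - k%:R) = wav l e k a.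
Proof.
have M0 : (0 < 2 ^ l)%N by rewrite expn_gt0.
have blk : (a %/ 2 ^ l.+1 == k)%N = ((2 * k + 0) * 2 ^ l <= a < (2 * k + 2) * 2 ^ l)%N.
  rewrite divn_block ?expn_gt0// expnS.
  congr (_ && _); [congr (_ <= _)%N|congr (_ < _)%N]; nia.
have i0 := ind01_mid l k a 0 2; have i1 := ind01_mid l k a 0 1.
have i2 := ind01_mid l k a 1 2.
rewrite mul0r divff ?pnatr_eq0// in i0; rewrite mul0r in i1; rewrite divff ?pnatr_eq0// in i2.
case: e; rewrite /He /H0 /H1 /wav /=; last by rewrite i0 blk expr0 mulr1.
rewrite i1 i2 blk.
have [h|h] := ltnP a ((2 * k + 1) * 2 ^ l).
  have [h0|h0] := leqP ((2 * k + 0) * 2 ^ l) a; last by rewrite /= ?mul0r ?mulr0n ?subrr.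
  have -> : (a %/ 2 ^ l = 2 * k)%N.
    by apply/eqP; rewrite divn_block//; apply/andP; split; nia.
  have -> : (a < (2 * k + 2) * 2 ^ l)%N by nia.
  by rewrite oddM /= expr0 mulr1; lra.
have [h0|h0] := ltnP a ((2 * k + 2) * 2 ^ l); last first.
  by rewrite /= ?andbF ?mul0r ?mulr0n ?subrr.
have -> : (a %/ 2 ^ l = (2 * k).+1)%N.
  by apply/eqP; rewrite divn_block//; apply/andP; split; nia.
have -> : ((2 * k + 0) * 2 ^ l <= a)%N by nia.
by rewrite /= oddM /= expr1; lra.
Qed.

Lemma sum_blocks (Q M : nat) (f : nat -> R) : (0 < M)%N ->
  \sum_(a < Q * M) f (a %/ M)%N = M%:R * \sum_(i < Q) f i.
Proof.
move=> M0; rewrite -(big_mkord xpredT (fun a => f (a %/ M)%N)) big_nat_mul big_mkord.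
rewrite mulr_sumr; apply: eq_bigr => i _.
under eq_big_nat => a /andP[h1 h2].
  have -> : (a %/ M = i)%N.
    by apply/eqP; rewrite divn_block// h1 h2.
  over.
by rewrite big_const_nat iter_addr addr0 mulSn addnK mulr_natl.
Qed.

(** The factor [g] is constant on each block while the sign flips between its halves, so the halves
    cancel. Mean zero and all orthogonality between distinct scales or orientations come from
    this. *)
Lemma alternating_sum (n l : nat) (g : nat -> R) : (l < n)%N ->
  \sum_(a < 2 ^ n) g (a %/ 2 ^ l.+1)%N * (-1) ^+ odd (a %/ 2 ^ l) = 0.
Proof.
move=> ln; under eq_bigr do rewrite expnSr divnMA.
have -> : (2 ^ n = (2 ^ (n - l.+1) * 2) * 2 ^ l)%N by rewrite -mulnA -expnS -expnD subnK.
rewrite (sum_blocks _ (fun i => g (i %/ 2)%N * (-1) ^+ odd i)) ?expn_gt0//.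
rewrite -(big_mkord xpredT (fun i => g (i %/ 2)%N * (-1) ^+ odd i)) big_nat_mul big1 ?mulr0// => i _.
rewrite mulSn addnC addn2 big_nat_recr ?leqW//= big_nat1 oddM andbF /= expr0 expr1 mulr1 mulrN1.
by rewrite mulnK// -addn1 divnMDl// addn0 subrr.
Qed.

Lemma wav_sum_same (n l k k' : nat) (e e' : bool) : (l < n)%N -> (k < 2 ^ (n - l.+1))%N ->
  \sum_(a < 2 ^ n) wav l e k a * wav l e' k' a =
  (2 ^ l.+1)%:R * ((e == e') && (k == k'))%:R.
Proof.
move=> ln kn.
have [<-|ee] := eqVneq e e'; last first.
  rewrite mulr0 -[RHS](alternating_sum (fun q => (q == k)%:R * (q == k')%:R) ln).
  apply: eq_bigr => a _; rewrite /wav.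
  by case: e e' ee => -[] //= _; rewrite expr0; ring.
have -> : (2 ^ n = 2 ^ (n - l.+1) * 2 ^ l.+1)%N by rewrite -expnD subnK.
transitivity (\sum_(a < 2 ^ (n - l.+1) * 2 ^ l.+1)
    (fun q => (q == k)%:R * (q == k')%:R) (a %/ 2 ^ l.+1)%N : R).
  by apply: eq_bigr => a _; rewrite /wav mulrACA -expr2 sqrr_sign mulr1.
rewrite (sum_blocks _ (fun q => (q == k)%:R * (q == k')%:R)) ?expn_gt0//; congr (_ * _).
rewrite (bigD1 (Ordinal kn)) //= eqxx mul1r big1 ?addr0// => i.
by rewrite -val_eqE /= => /negbTE ->; rewrite mul0r.
Qed.

(** The coarser function is constant on the blocks of the finer one: it is a Haar function of the
    block index, at scale [l - l'.+1]. *)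
Lemma wav_sum_lt (n l l' k k' : nat) (e : bool) : (l' < l)%N -> (l < n)%N ->
  \sum_(a < 2 ^ n) wav l e k a * wav l' true k' a = 0.
Proof.
move=> ll ln.
have l'n : (l' < n)%N by apply: ltn_trans ln.
rewrite -[RHS](alternating_sum
  (fun q => wav (l - l'.+1) e k q * (q == k')%:R) l'n).
apply: eq_bigr => a _; rewrite {2}/wav /= mulrA; congr (_ * _ * _); rewrite /wav.
by rewrite -!divnMA -!expnD addnS !subnKC.
Qed.

End Wavelet.

(* Level, orientation and position of the [(p, q)]-th Haar function, as laid
   out by [haar_val]. *)
Definition hlev (p q : nat) : nat := trunc_log 2 (maxn p q).
Definition hori (p q x : nat) : bool := (2 ^ hlev p q <= x)%N.
Definition hpos (p q x : nat) : nat := (x - hori p q x * 2 ^ hlev p q)%N.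

Lemma max_lt_hlev (p q : nat) : (maxn p q < 2 ^ (hlev p q).+1)%N.
Proof. exact: trunc_log_ltn. Qed.

Lemma hpos_lt (p q x : nat) : (x <= maxn p q)%N -> (hpos p q x < 2 ^ hlev p q)%N.
Proof.
move=> xpq; have := leq_ltn_trans xpq (max_lt_hlev p q).
rewrite /hpos /hori expnS; case: leqP => /=; have := expn_gt0 2 (hlev p q); lia.
Qed.

Lemma hposK (p q x : nat) : (hpos p q x + hori p q x * 2 ^ hlev p q)%N = x.
Proof. rewrite /hpos subnK// /hori; case: leqP => /=; rewrite ?mul1n ?mul0n; lia. Qed.

(** The larger index reaches [2 ^ hlev p q], so every non-constant basis function oscillates in some
    variable. *)
Lemma hori_or (p q : nat) : (0 < maxn p q)%N -> hori p q p || hori p q q.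
Proof. by move=> m0; rewrite /hori -leq_max; apply: trunc_logP. Qed.

Lemma hlev_lt (n p q : nat) : (0 < n)%N -> (p < 2 ^ n)%N -> (q < 2 ^ n)%N -> (hlev p q < n)%N.
Proof.
move=> n0 pn qn; have [m0|m0] := posnP (maxn p q); first by rewrite /hlev m0.
rewrite -(ltn_exp2l _ _ (isT : (1 < 2)%N)).
by apply: leq_ltn_trans (trunc_logP _ m0) _ => //; rewrite gtn_max pn qn.
Qed.

(** * The bivariate Haar basis as a real orthonormal matrix *)

Section HaarBasis.
Variables (R : realType) (n : nat).
Hypothesis n0 : (0 < n)%N.
Local Notation C := R[i].
Local Notation N := (2 ^ n)%N.
Local Notation pix := ('I_N * 'I_N)%type.

(** Scale in pixels: the support of the [i]-th basis function is a square of side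
    [2 ^ (hlog i).+1]. *)
Definition hlog (i : pix) : nat := (n - (hlev i.1 i.2).+1)%N.
Definition hw1 (i : pix) (a : nat) : R := wav R (hlog i) (hori i.1 i.2 i.1) (hpos i.1 i.2 i.1) a.
Definition hw2 (i : pix) (b : nat) : R := wav R (hlog i) (hori i.1 i.2 i.2) (hpos i.1 i.2 i.2) b.
Definition haar_mx (i x : pix) : R := hw1 i x.1 * hw2 i x.2 / (2 ^ (hlog i).+1)%:R.

Lemma hlev_ltn (i : pix) : (hlev i.1 i.2 < n)%N.
Proof. exact: hlev_lt. Qed.

Lemma hlog_ltn (i : pix) : (hlog i < n)%N.
Proof. by have := hlev_ltn i; rewrite /hlog; lia. Qed.

Lemma hlogK (i : pix) : (n - (hlog i).+1)%N = hlev i.1 i.2.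
Proof. by have := hlev_ltn i; rewrite /hlog; lia. Qed.

Lemma haar_atomE (i x : pix) : haar_atom R i.1 i.2 x.1 x.2 = ((haar_mx i x)%:C)%C.
Proof.
rewrite mxE; congr ((_)%:C)%C.
have pow : (2 ^ n)%:R = 2 ^+ hlev i.1 i.2 * (2 ^ (hlog i).+1)%:R :> R.
  by rewrite -hlogK -natrX -natrM -expnD subnK// hlog_ltn.
have J0 : 0 < 2 ^+ hlev i.1 i.2 :> R by rewrite exprn_gt0.
have L0 : 0 < (2 ^ (hlog i).+1)%:R :> R by rewrite ltr0n expn_gt0.
have scale (a : nat) : 2 ^+ hlev i.1 i.2 * ((a%:R + 1 / 2) / N%:R) =
    (a%:R + 1 / 2) / (2 ^ (hlog i).+1)%:R :> R.
  by rewrite pow; field; rewrite !gt_eqF.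
have -> : haar_val n i.1 i.2 ((x.1%:R + 1 / 2) / N%:R) ((x.2%:R + 1 / 2) / N%:R) =
    2 ^+ hlev i.1 i.2 * hw1 i x.1 * hw2 i x.2.
  rewrite /haar_val; case: eqVneq => [m0|_]; last first.
    by rewrite /haar_fun !scale !He_wav.
  (* Since [trunc_log 2 0 = 0], the constant function fits the general formula: level 0, one block,
     no oscillation. *)
  rewrite /hw1 /hw2 /hpos /hori /hlog /hlev m0.
  have [-> ->] : (nat_of_ord i.1 = 0 /\ nat_of_ord i.2 = 0)%N.
    by move: m0; rewrite /maxn; case: ifP; lia.
  rewrite trunc_log0 /= /wav /= subn1 prednK// !divn_small ?eqxx ?mulr1//.
by rewrite /haar_mx pow; field; rewrite !gt_eqF.
Qed.

(** The inner product splits into two one-dimensional ones. At different scales the finer function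
    oscillates in some variable, which kills that factor; at equal scales, orientation and position
    determine the index through [hposK]. *)
Lemma haar_mx_orthonormal (i j : pix) : \sum_x haar_mx i x * haar_mx j x = (i == j)%:R.
Proof.
have sep : \sum_x haar_mx i x * haar_mx j x =
    (\sum_(a < N) hw1 i a * hw1 j a) * (\sum_(b < N) hw2 i b * hw2 j b)
      / ((2 ^ (hlog i).+1)%:R * (2 ^ (hlog j).+1)%:R).
  rewrite big_distrlr /= pair_bigA mulr_suml; apply: eq_bigr => x _.
  by rewrite /haar_mx invfM; ring.
wlog ij : i j sep / (hlog j <= hlog i)%N.
  move=> H; have [/H->//|/ltnW/H h] := leqP (hlog j) (hlog i).
  rewrite eq_sym -h; first by apply: eq_bigr => x _; rewrite mulrC.
  under eq_bigr do rewrite mulrC.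
  rewrite sep; congr (_ * _ / _); last by rewrite mulrC.
    by apply: eq_bigr => a _; rewrite mulrC.
  by apply: eq_bigr => a _; rewrite mulrC.
rewrite sep {sep}.
have posi := hlogK i.
move: ij; rewrite leq_eqVlt => /orP[/eqP ij|ij]; last first.
  have -> : (i == j) = false by apply: contraTF ij => /eqP ->; rewrite ltnn.
  have : hori j.1 j.2 j.1 || hori j.1 j.2 j.2.
    (* Index zero has the coarsest scale, so the strictly finer [j] is not it. *)
    apply: hori_or; case: posnP => // m0.
    by move: ij (hlog_ltn i); rewrite /hlog /hlev m0 trunc_log0; lia.
  have z := wav_sum_lt R _ _ _ ij (hlog_ltn i).
  by case/orP => h; rewrite /hw1 /hw2 h z ?mul0r ?mulr0 ?mul0r.
rewrite /hw1 /hw2 ij !wav_sum_same ?hlog_ltn ?hlogK ?hpos_lt ?leq_maxl ?leq_maxr//.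
have L0 : (2 ^ (hlog i).+1)%:R != 0 :> R by rewrite pnatr_eq0 expn_eq0.
transitivity (((hori i.1 i.2 i.1 == hori j.1 j.2 j.1) && (hpos i.1 i.2 i.1 == hpos j.1 j.2 j.1))%:R
  * ((hori i.1 i.2 i.2 == hori j.1 j.2 j.2) && (hpos i.1 i.2 i.2 == hpos j.1 j.2 j.2))%:R : R).
  by rewrite mulrACA [LHS]mulrAC divff ?mul1r// mulf_neq0.
rewrite mulr_natr -mulrnA mulnb; congr (_%:R); congr nat_of_bool.
have lev : hlev i.1 i.2 = hlev j.1 j.2 by rewrite -!hlogK ij.
apply/idP/eqP => [|->]; last by rewrite !eqxx.
move=> /andP[/andP[/eqP e1 /eqP k1] /andP[/eqP e2 /eqP k2]].
case: i j lev e1 k1 e2 k2 {ij posi L0} => [p q] [p' q'] /= lev e1 k1 e2 k2.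
congr pair; apply/val_inj => /=.
  by rewrite -(hposK p q p) -(hposK p' q' p') e1 k1 lev.
by rewrite -(hposK p q q) -(hposK p' q' q') e2 k2 lev.
Qed.

End HaarBasis.

(** * Haar coefficients and total variation *)

Lemma conjcMr (R : realType) (z : R[i]) (r : R) :
  ((z * (r%:C))^* = z^* * (r%:C))%C.
Proof. by rewrite rmorphM /= oppr0. Qed.

(** Parseval: the squared moduli are expanded as [z * z^*], and column orthonormality leaves only
    the diagonal. *)
Lemma l2norm_orthogonal (R : realType) (I : finType) (u : I -> I -> R) (d : I -> R[i]) :
  (forall i j, \sum_k u k i * u k j = (i == j)%:R) ->
  l2norm (fun i => \sum_x d x * ((u i x)%:C)%C) = l2norm d.
Proof.
move=> uu; congr Num.sqrt; apply: complexI; rewrite !rmorph_sum /=.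
under eq_bigr => i _.
  rewrite sqr_cabs rmorph_sum big_distrlr /=.
  under eq_bigr => x _ do under eq_bigr => y _ do
    rewrite conjcMr mulrACA -rmorphM.
  over.
rewrite exchange_big; apply: eq_bigr => x _ /=.
rewrite exchange_big (bigD1 x) //= [X in _ + X]big1 => [|y yx].
  by rewrite addr0 -mulr_sumr -rmorph_sum uu eqxx mulr1 sqr_cabs.
by rewrite -mulr_sumr -rmorph_sum uu eq_sym (negbTE yx) rmorph0 mulr0.
Qed.

Section HaarTransform.
Variables (R : realType) (n : nat).
Hypothesis n0 : (0 < n)%N.
Local Notation C := R[i].
Local Notation N := (2 ^ n)%N.
Local Notation pix := ('I_N * 'I_N)%type.
Implicit Types (D : 'M[C]_N) (i x : pix).

Lemma haarE D i : haar D i.1 i.2 = \sum_x D x.1 x.2 * ((haar_mx R i x)%:C)%C.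
Proof.
rewrite mxE /minner pair_bigA; apply: eq_bigr => x _.
by rewrite haar_atomE// conjc_real.
Qed.

Lemma haar_invE (c : 'M[C]_N) x :
  haar_inv c x.1 x.2 = \sum_i c i.1 i.2 * ((haar_mx R i x)%:C)%C.
Proof.
rewrite /haar_inv pair_bigA summxE; apply: eq_bigr => i _.
by rewrite mxE haar_atomE.
Qed.

Lemma haar_mx_col_orthonormal x y : \sum_i haar_mx R i x * haar_mx R i y = (x == y)%:R.
Proof. exact: (orthogonal_tr (haar_mx_orthonormal R n0)). Qed.

Lemma haarK D : haar_inv (haar D) = D.
Proof.
apply/matrixP => a b; rewrite (haar_invE _ (a, b)).
under eq_bigr => i _.
  rewrite haarE mulr_suml.
  under eq_bigr => x _ do rewrite -mulrA -rmorphM.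
  over.
rewrite exchange_big (bigD1 (a, b)) //= [X in _ + X]big1 => [|x xab].
  by rewrite addr0 -mulr_sumr -rmorph_sum haar_mx_col_orthonormal eqxx mulr1.
by rewrite -mulr_sumr -rmorph_sum haar_mx_col_orthonormal (negbTE xab) rmorph0 mulr0.
Qed.

Lemma mnorm2_haar D : mnorm2 (haar D) = mnorm2 D.
Proof.
rewrite /mnorm2 -[RHS](l2norm_orthogonal _ haar_mx_col_orthonormal).
by apply: eq_l2norm => i /=; rewrite haarE.
Qed.

Lemma haar_invD (c d : 'M[C]_N) : haar_inv (c + d) = haar_inv c + haar_inv d.
Proof.
apply/matrixP => a b; rewrite mxE !(haar_invE _ (a, b)) -big_split /=.
by apply: eq_bigr => i _; rewrite mxE mulrDl.
Qed.

Definition fdiff (f : 'I_N -> C) (a : 'I_N) : C :=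
  if insub a.+1 is Some a' then f a' - f a else 0.

(** Telescoping from [a0] to [a] stays inside the block; the remaining differences only add
    nonnegative terms. *)
Lemma ler_osc_fdiff (f : 'I_N -> C) (M k : nat) (a0 a : 'I_N) :
  (a0 <= a)%N -> (0 < M)%N -> (a0 %/ M = k)%N -> (a %/ M = k)%N ->
  cabs (f a - f a0) <= \sum_(i : 'I_N | (i %/ M == k)%N) cabs (fdiff f i).
Proof.
move=> a0a M0 a0k ak.
pose g (i : nat) : C := if insub i is Some i' then f i' else 0.
have gE (i : 'I_N) : f i = g i by rewrite /g valK.
pose dg (i : nat) : C := if (i.+1 < N)%N then g i.+1 - g i else 0.
have dgE (i : 'I_N) : fdiff f i = dg i.
  by rewrite /fdiff /dg gE /g; case: insubP => [i' -> _|/negbTE ->].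
rewrite !gE -telescope_sumr//.
apply: le_trans (ler_cabs_sum _ _ _) _.
have -> : \sum_(i : 'I_N | (i %/ M == k)%N) cabs (fdiff f i) =
    \sum_(0 <= i < N | (i %/ M == k)%N) cabs (dg i).
  by rewrite big_mkord; apply: eq_bigr => i _; rewrite dgE.
rewrite (big_cat_nat (leq0n a0)) /=; last by apply/ltnW.
rewrite [X in _ <= _ + X](big_cat_nat a0a) /=; last by apply/ltnW.
rewrite [X in _ <= _ + (X + _)]big_mkcond /=.
apply: (@le_trans _ _ (\sum_(a0 <= i < a) (if (i %/ M == k)%N then cabs (dg i) else 0))).
  rewrite le_eqVlt; apply/orP; left; apply/eqP; apply: eq_big_nat => i /andP[i1 i2].
  have -> : (i %/ M == k)%N.
    by rewrite eqn_leq -{1}ak -a0k !leq_div2r// ltnW.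
  by rewrite /dg (leq_ltn_trans i2).
rewrite -[leLHS]add0r lerD ?sumr_ge0// => [i _|]; first exact: cabs_ge0.
by rewrite lerDl sumr_ge0// => i _; apply: cabs_ge0.
Qed.

Lemma norm_wav l e k a : `|wav R l e k a| = (a %/ 2 ^ l.+1 == k)%N%:R.
Proof. by rewrite /wav normrM normr_sign mulr1 ger0_norm ?ler0n. Qed.

(* The detail wavelet has mean zero, so the value of [f] at the left end of the
   block may be subtracted from [f]. *)
Lemma wav_coef_le (f : 'I_N -> C) (l k : nat) : (l < n)%N -> (k < 2 ^ (n - l.+1))%N ->
  cabs (\sum_a f a * ((wav R l true k a)%:C)%C) <=
  (2 ^ l.+1)%:R * \sum_(a : 'I_N | (a %/ 2 ^ l.+1 == k)%N) cabs (fdiff f a).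
Proof.
move=> ln kn; set V := (X in _ <= _ * X).
have M0 : (0 < 2 ^ l.+1)%N by rewrite expn_gt0.
have a0N : (k * 2 ^ l.+1 < N)%N.
  by rewrite -(subnK ln) expnD ltn_pmul2r.
pose a0 := Ordinal a0N.
have mean0 : \sum_(a < N) wav R l true k a = 0.
  exact: (alternating_sum (fun q => (q == k)%:R) ln).
have -> : \sum_a f a * ((wav R l true k a)%:C)%C =
    \sum_a (f a - f a0) * ((wav R l true k a)%:C)%C.
  under [RHS]eq_bigr do rewrite mulrBl.
  by rewrite sumrB -mulr_sumr -rmorph_sum mean0 rmorph0 mulr0 subr0.
apply: le_trans (ler_cabs_sum _ _ _) _.
have V0 : 0 <= V by apply: sumr_ge0 => i _; apply: cabs_ge0.
(* The squared non-oscillating function is the block indicator, so [wav_sum_same] counts the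
   block. *)
apply: (@le_trans _ _ (\sum_(a < N) V * (wav R l false k a * wav R l false k a))).
  apply: ler_sum => a _; rewrite cabsM cabs_real norm_wav /wav /= expr0 mulr1.
  case: eqP => [ak|_]; rewrite ?mulr0// !mulr1.
  apply: ler_osc_fdiff => //; last by rewrite /= mulnK.
  by rewrite /= -ak leq_divM.
by rewrite -mulr_sumr (wav_sum_same R k false false ln kn) !eqxx mulr1 mulrC.
Qed.

Definition in_block i x : bool :=
  ((x.1 %/ 2 ^ (hlog i).+1 == hpos i.1 i.2 i.1) &&
   (x.2 %/ 2 ^ (hlog i).+1 == hpos i.1 i.2 i.2))%N.

Definition grad_size D x : R := \sum_c cabs (grad D (x.1, x.2, c)).

Lemma grad_sizeE D x :
  grad_size D x = cabs (fdiff (D^~ x.2) x.1) + cabs (fdiff (D x.1) x.2).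
Proof. by rewrite /grad_size big_ord_recl big_ord1. Qed.

Lemma sum_grad_size D : \sum_x grad_size D x = TV D.
Proof. by rewrite /TV /l1norm pair_bigA /=; apply: eq_bigr => -[[a b] c] _. Qed.

(** [wav_coef_le] is applied in the oscillating variable, and the other factor is bounded by its
    block indicator. The normalization cancels the block length, so no scale factor survives. *)
Lemma tensor_wav_coef_le (f : 'I_N -> 'I_N -> C) (l k k' : nat) (e : bool) :
  (l < n)%N -> (k < 2 ^ (n - l.+1))%N ->
  cabs (\sum_b \sum_a f a b * ((wav R l true k a * wav R l e k' b / (2 ^ l.+1)%:R)%:C)%C) <=
  \sum_(b : 'I_N | (b %/ 2 ^ l.+1 == k')%N)
    \sum_(a : 'I_N | (a %/ 2 ^ l.+1 == k)%N) cabs (fdiff (f^~ b) a).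
Proof.
move=> ln kn.
have L0 : 0 < (2 ^ l.+1)%:R :> R by rewrite ltr0n expn_gt0.
apply: le_trans (ler_cabs_sum _ _ _) _; rewrite [leRHS]big_mkcond /=.
apply: ler_sum => b _.
have -> : \sum_a f a b * ((wav R l true k a * wav R l e k' b / (2 ^ l.+1)%:R)%:C)%C =
    (\sum_a f a b * ((wav R l true k a)%:C)%C) * ((wav R l e k' b / (2 ^ l.+1)%:R)%:C)%C.
  rewrite mulr_suml; apply: eq_bigr => a _.
  by rewrite -[RHS]mulrA -(mulrA (wav _ _ _ _ _)) rmorphM.
rewrite cabsM cabs_real normrM norm_wav ger0_norm ?invr_ge0 ?ler0n//.
case: eqP => _; last by rewrite mul0r mulr0.
by rewrite mul1r ler_pdivrMr// mulrC wav_coef_le.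
Qed.

(** An oscillating direction selects the gradient component to use; the other is dropped as
    nonnegative. *)
Lemma haar_coef_le D i : (0 < maxn i.1 i.2)%N ->
  cabs (haar D i.1 i.2) <= \sum_(x | in_block i x) grad_size D x.
Proof.
move=> /hori_or i0; rewrite haarE.
have ln := hlog_ltn n0 i.
have k1 : (hpos i.1 i.2 i.1 < 2 ^ (n - (hlog i).+1))%N by rewrite hlogK ?hpos_lt ?leq_maxl.
have k2 : (hpos i.1 i.2 i.2 < 2 ^ (n - (hlog i).+1))%N by rewrite hlogK ?hpos_lt ?leq_maxr.
have -> : \sum_(x | in_block i x) grad_size D x =
    \sum_(a : 'I_N | (a %/ 2 ^ (hlog i).+1 == hpos i.1 i.2 i.1)%N)
    \sum_(b : 'I_N | (b %/ 2 ^ (hlog i).+1 == hpos i.1 i.2 i.2)%N) grad_size D (a, b).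
  rewrite [RHS]pair_big /=; apply: eq_big => [x|[a b]] //.
rewrite -(pair_bigA _ (fun a b => D a b * ((haar_mx R i (a, b))%:C)%C)) /=.
case/orP: i0 => h.
  rewrite exchange_big [leRHS]exchange_big.
  have := tensor_wav_coef_le (fun a b => D a b) (hpos i.1 i.2 i.2) (hori i.1 i.2 i.2) ln k1.
  rewrite /haar_mx /hw1 /hw2 h /= => H; apply: le_trans H _.
  apply: ler_sum => b _; apply: ler_sum => a _.
  by rewrite grad_sizeE lerDl cabs_ge0.
have := tensor_wav_coef_le (fun b a => D a b) (hpos i.1 i.2 i.1) (hori i.1 i.2 i.1) ln k2.
have -> : \sum_a \sum_b D a b * ((haar_mx R i (a, b))%:C)%C =
    \sum_a \sum_b D a b * ((wav R (hlog i) true (hpos i.1 i.2 i.2) b *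
      wav R (hlog i) (hori i.1 i.2 i.1) (hpos i.1 i.2 i.1) a / (2 ^ (hlog i).+1)%:R)%:C)%C.
  apply: eq_bigr => a _; apply: eq_bigr => b _.
  by rewrite /haar_mx /hw1 /hw2 h /= [wav _ _ _ _ a * _]mulrC.
move=> H; apply: le_trans H _.
apply: ler_sum => a _; apply: ler_sum => b _.
by rewrite grad_sizeE lerDr cabs_ge0.
Qed.

(** The pixel forces the position at each level, so the level and two orientation bits encode [i]:
    [n * 2 * 2] codes. *)
Lemma card_blocks_le x : (#|[set i | in_block i x]| <= 4 * n)%N.
Proof.
pose code i : 'I_n * bool * bool :=
  (Ordinal (hlev_ltn n0 i), hori i.1 i.2 i.1, hori i.1 i.2 i.2).
have code_inj : {in [set i | in_block i x] &, injective code}.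
  move=> [p q] [p' q']; rewrite !inE /in_block /code /hlog /=.
  move=> /andP[/eqP k1 /eqP k2] /andP[/eqP k1' /eqP k2'] [lev e1 e2].
  rewrite -lev {}k1 {}k2 in k1' k2'.
  congr pair; apply/val_inj => /=.
    by rewrite -(hposK p q p) -(hposK p' q' p') k1' e1 lev.
  by rewrite -(hposK p q q) -(hposK p' q' q') k2' e2 lev.
rewrite -(card_in_imset code_inj); apply: leq_trans (max_card _) _.
by rewrite !card_prod card_ord card_bool; lia.
Qed.

Lemma l1norm_haar_details D :
  \sum_(i : pix | (0 < maxn i.1 i.2)%N) cabs (haar D i.1 i.2) <= (4 * n)%:R * TV D.
Proof.
apply: (@le_trans _ _ (\sum_i \sum_(x | in_block i x) grad_size D x)).
  rewrite big_mkcond; apply: ler_sum => i _ /=; case: ifP => [/haar_coef_le//|_].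
  by apply: sumr_ge0 => x _; apply: sumr_ge0 => c _; apply: cabs_ge0.
rewrite (exchange_big_dep xpredT) //= -sum_grad_size mulr_sumr; apply: ler_sum => x _.
rewrite sumr_const -[leLHS]mulr_natl ler_wpM2r//.
  by apply: sumr_ge0 => c _; apply: cabs_ge0.
by rewrite ler_nat -(cardsE (in_block^~ x)) card_blocks_le.
Qed.

End HaarTransform.

(** * Recovery by total variation minimization *)

Section Gradient.
Variables (R : realType) (n : nat).
Local Notation C := R[i].
Local Notation N := (2 ^ n)%N.
Implicit Types (D X : 'M[C]_N) (T : {set 'I_N * 'I_N * 'I_2}).

Lemma sum_sqr_fdiff (f : 'I_N -> C) :
  \sum_a cabs (fdiff f a) ^+ 2 <= 4 * \sum_a cabs (f a) ^+ 2.
Proof.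
pose h (i : nat) : R := if insub i is Some a then cabs (f a) ^+ 2 else 0.
have h0 i : 0 <= h i by rewrite /h; case: insub => // a; apply: sqr_ge0.
have hE (a : 'I_N) : cabs (f a) ^+ 2 = h a by rewrite /h valK.
apply: (@le_trans _ _ (\sum_(a < N) (2 * h a.+1 + 2 * h a))).
  apply: ler_sum => a _; rewrite -hE /fdiff /h; case: insub => [a'|]; last first.
    by rewrite cabs0 expr0n /= mulr0 add0r mulr_ge0 ?sqr_ge0.
  have := ler_cabsB (f a') (f a); have := cabs_ge0 (f a' - f a).
  have := sqr_ge0 (cabs (f a') - cabs (f a)); nra.
(* The default value past the edge makes the shifted sum no larger than the original. *)
have hN : h N = 0 by rewrite /h insubF ?ltnn.
have shift : \sum_(a < N) h a.+1 <= \sum_(a < N) h a.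
  have <- : \sum_(a < N.+1) h a = \sum_(a < N) h a by rewrite big_ord_recr /= hN addr0.
  by rewrite big_ord_recl lerDr.
have -> : \sum_a cabs (f a) ^+ 2 = \sum_(a < N) h a by apply: eq_bigr.
by rewrite big_split /= -!mulr_sumr; lra.
Qed.

(** Each of the two directions contributes a factor 4 to the square, and [8 <= 3 ^ 2]. *)
Lemma l2norm_grad_le D : l2norm (grad D) <= 3 * mnorm2 D.
Proof.
apply: ler_l2norm; first by rewrite mulr_ge0 ?l2norm_ge0.
rewrite exprMn /mnorm2 sqr_l2norm.
have -> : \sum_i cabs (grad D i) ^+ 2 =
    \sum_b \sum_a cabs (fdiff (D^~ b) a) ^+ 2 + \sum_a \sum_b cabs (fdiff (D a) b) ^+ 2.
  rewrite exchange_big -big_split /=.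
  under [RHS]eq_bigr => a _ do rewrite -big_split /=.
  rewrite [RHS]pair_bigA /=.
  transitivity (\sum_(x : 'I_N * 'I_N) \sum_c cabs (grad D (x, c)) ^+ 2).
    by rewrite pair_bigA /=; apply: eq_bigr => -[x c] _.
  by apply: eq_bigr => -[a b] _; rewrite big_ord_recl big_ord1.
have S1 : \sum_b \sum_a cabs (fdiff (D^~ b) a) ^+ 2 <= 4 * \sum_a \sum_b cabs (D a b) ^+ 2.
  rewrite [in leRHS]exchange_big mulr_sumr; apply: ler_sum => b _.
  exact: sum_sqr_fdiff.
have S2 : \sum_a \sum_b cabs (fdiff (D a) b) ^+ 2 <= 4 * \sum_a \sum_b cabs (D a b) ^+ 2.
  by rewrite mulr_sumr; apply: ler_sum => a _; apply: sum_sqr_fdiff.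
rewrite -(pair_bigA _ (fun a b => cabs (D a b) ^+ 2)) /=.
have : 0 <= \sum_a \sum_b cabs (D a b) ^+ 2.
  by apply: sumr_ge0 => a _; apply: sumr_ge0 => b _; apply: sqr_ge0.
lra.
Qed.

Lemma gradB X D i : grad (X - D) i = grad X i - grad D i.
Proof.
case: i => -[a b] c /=; case: ifP => _; case: insub => [a'|]; rewrite ?subr0// !mxE; ring.
Qed.

Lemma l1norm_sparse_residual X T :
  l1norm (fun i => grad X i - sparse_part (grad X) T i) = \sum_(i | i \notin T) cabs (grad X i).
Proof.
rewrite /l1norm [RHS]big_mkcond; apply: eq_bigr => i _ /=.
by rewrite /sparse_part; case: (i \in T); rewrite ?subrr ?cabs0 ?subr0.
Qed.

(** Passing from [X] to [X - D] lowers the gradient on [T] by at most that of [D] there, so the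
    total variation can fail to grow only if the gradient of [D] off [T] is dominated by its part on
    [T] and the tail of [X]. *)
Lemma TV_cone X D T : TV (X - D) <= TV X ->
  TV D <= 2 * \sum_(i in T) cabs (grad D i) + 2 * \sum_(i | i \notin T) cabs (grad X i).
Proof.
have tri (x y : C) : cabs x <= cabs (y - x) + cabs y.
  by have := ler_cabsB y (y - x); rewrite subKr [X in _ <= X]addrC.
rewrite /TV /l1norm (bigID (mem T)) [X in _ <= X -> _](bigID (mem T)) [X in _ -> X <= _](bigID (mem T)) /=.
have inT : \sum_(i in T) cabs (grad X i) <=
    \sum_(i in T) cabs (grad (X - D) i) + \sum_(i in T) cabs (grad D i).
  by rewrite -big_split; apply: ler_sum => i _; rewrite gradB -{1}[grad X i](subrK (grad D i)) ler_cabsD.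
have outT : \sum_(i | i \notin T) cabs (grad D i) <=
    \sum_(i | i \notin T) cabs (grad (X - D) i) + \sum_(i | i \notin T) cabs (grad X i).
  by rewrite -big_split; apply: ler_sum => i _; rewrite gradB tri.
lra.
Qed.

End Gradient.

Lemma ln_pow2_cube (R : realType) n : ln ((2 ^ n)%:R : R) ^+ 3 = n%:R ^+ 3 * ln (2 : R) ^+ 3.
Proof. by rewrite natrX lnXn ?ltr0n// -[_ *+ n]mulr_natl exprMn. Qed.

(** * Strong Sobolev inequality from the restricted isometry property *)

Section Recovery.
Variables (R : realType) (n m : nat).
Hypothesis n0 : (0 < n)%N.
Local Notation C := R[i].
Local Notation N := (2 ^ n)%N.
Local Notation pix := ('I_N * 'I_N)%type.
Variable A : {linear 'M[C]_N -> 'cV[C]_m}.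

Lemma ler_vnorm2D (x y : 'cV[C]_m) : vnorm2 (x + y) <= vnorm2 x + vnorm2 y.
Proof.
apply: le_trans (ler_l2normD _ _); rewrite le_eqVlt; apply/orP; left; apply/eqP.
by apply: eq_l2norm => i; rewrite mxE.
Qed.

Lemma vnorm2N (x : 'cV[C]_m) : vnorm2 (- x) = vnorm2 x.
Proof. by rewrite -[RHS]l2normN; apply: eq_l2norm => i; rewrite mxE. Qed.

(** [sparse_recovery] is applied to the Haar coefficients, exempting the constant one, which total
    variation does not see. The factor is [36 = 9 * 4], with [4 * n] from [l1norm_haar_details]. *)
Lemma strong_sobolev (t : nat) (delta r : R) :
  (0 < t)%N -> t.+1%:R <= r -> delta < 1 / 3 ->
  RIP (fun c => A (haar_inv c)) r delta ->
  forall D, mnorm2 D <= 2 * vnorm2 (A D) + 36 * n%:R * TV D / Num.sqrt t%:R.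
Proof.
move=> t0 tr d3 rip D.
pose mx (x : {ffun pix -> C}) : 'M[C]_N := \matrix_(p, q) x (p, q).
pose F x := vnorm2 (A (haar_inv (mx x))).
have mxD x y : mx (x + y) = mx x + mx y by apply/matrixP => p q; rewrite !mxE ffunE.
have norm_mx x : mnorm2 (mx x) = l2norm x.
  by apply: eq_l2norm => -[p q] /=; rewrite mxE.
have nnz_mx x : nnz (mx x) = #|supp x|.
  by rewrite /nnz; apply: eq_card => -[p q]; rewrite !inE mxE.
have F_subadd x y : F (x + y) <= F x + F y.
  by rewrite /F mxD haar_invD// raddfD ler_vnorm2D.
have F_ge0 x : 0 <= F x by apply: l2norm_ge0.
have rip_mx x : (#|supp x| <= t.+1)%N ->
    (1 - delta) * l2norm x ^+ 2 <= F x ^+ 2 /\ F x ^+ 2 <= (1 + delta) * l2norm x ^+ 2.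
  by move=> xt; rewrite -norm_mx; apply: rip; rewrite nnz_mx (le_trans _ tr)// ler_nat.
have F_le x : (#|supp x| <= t)%N -> F x <= 2 * l2norm x.
  move=> /leqW/rip_mx[_ h].
  rewrite -(@ler_pXn2r _ 2) ?nnegrE ?mulr_ge0 ?l2norm_ge0// exprMn.
  apply: le_trans h _; rewrite ler_wpM2r ?sqr_ge0//; lra.
(* Here [1 - delta > 2 / 3], well above the required [1 / 4]. *)
have F_ge x : (#|supp x| <= t.+1)%N -> l2norm x <= 2 * F x.
  move=> /rip_mx[h _].
  rewrite -(@ler_pXn2r _ 2) ?nnegrE ?mulr_ge0 ?l2norm_ge0// exprMn.
  have : (1 / 4) * l2norm x ^+ 2 <= (1 - delta) * l2norm x ^+ 2.
    by rewrite ler_wpM2r ?sqr_ge0//; lra.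
  lra.
have N0 : (0 < N)%N by rewrite expn_gt0.
pose i0 : pix := (Ordinal N0, Ordinal N0).
pose c : {ffun pix -> C} := [ffun i => haar D i.1 i.2].
have mxc : mx c = haar D by apply/matrixP => p q; rewrite mxE ffunE.
have := sparse_recovery t0 F_subadd F_le F_ge i0 c.
rewrite -norm_mx mxc mnorm2_haar// /F mxc haarK// => h.
apply: le_trans h _; rewrite lerD2l ler_wpM2r ?invr_ge0 ?sqrtr_ge0//.
have := l1norm_haar_details n0 D; rewrite natrM => L.
have : \sum_(i | i != i0) cabs (c i) <= \sum_(i : pix | (0 < maxn i.1 i.2)%N) cabs (haar D i.1 i.2).
  rewrite le_eqVlt; apply/orP; left; apply/eqP; apply: eq_big => [[p q]|i _]; last by rewrite ffunE.
  by rewrite /i0 xpair_eqE -!val_eqE /=; lia.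
lra.
Qed.

End Recovery.

Unset Implicit Arguments.

Theorem theorem5 (R : realType) :
  exists C0 : R, 0 < C0 /\
  exists K : R, 0 < K /\
  forall (n m s : nat) (A : {linear 'M[R[i]]_(2 ^ n) -> 'cV[R[i]]_m}) (delta : R),
    (0 < n)%N -> (0 < s)%N -> delta < 1 / 3 ->
    RIP (fun c => A (haar_inv c)) (C0 * s%:R * ln ((2 ^ n)%:R : R) ^+ 3) delta ->
    forall (X : 'M[R[i]]_(2 ^ n)) (xi : 'cV[R[i]]_m) (eps : R)
           (Xhat : 'M[R[i]]_(2 ^ n)) (T : {set 'I_(2 ^ n) * 'I_(2 ^ n) * 'I_2}),
      vnorm2 xi <= eps ->
      is_TV_min A (A X + xi) eps Xhat ->
      is_best_support s (grad X) T ->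
      mnorm2 (X - Xhat) <=
        K * (l1norm (fun i => grad X i - sparse_part (grad X) T i) / Num.sqrt s%:R
             + eps).
Proof.
have l2 : 0 < ln (2 : R) by rewrite ln_gt0// ltr1n.
have l23 : 0 < ln (2 : R) ^+ 3 by rewrite exprn_gt0.
(* Dividing by [ln 2 ^+ 3] turns the cubed logarithm into [n ^ 3]; the factor 2 absorbs the
   successor in [t.+1]. *)
exists (2 * 432 ^+ 2 / ln 2 ^+ 3); split; first by rewrite divr_gt0// mulr_gt0// exprn_gt0// ltr0n.
(* The data term is [2 * (2 * eps)], doubled when half of [mnorm2 D] is absorbed. *)
exists 8; split=> // n m s A delta n0 s0 d3 rip X xi eps Xhat T xie [Xhe Xmin] [Ts _].
(* [432] is chosen so that the multiple of [mnorm2 D] in the bound below is [1 / 2]. *)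
pose t := ((432 * n) ^ 2 * s)%N.
have t0 : (0 < t)%N by rewrite muln_gt0 expn_gt0 muln_gt0 n0 s0.
have t_le : t.+1%:R <= 2 * 432 ^+ 2 / ln 2 ^+ 3 * s%:R * ln ((2 ^ n)%:R : R) ^+ 3.
  rewrite ln_pow2_cube [leRHS](_ : _ = 2 * 432 ^+ 2 * s%:R * n%:R ^+ 3).
    have x1 : 1 <= n%:R :> R by rewrite ler1n.
    have y1 : 1 <= s%:R :> R by rewrite ler1n.
    have h1 : 1 <= n%:R ^+ 2 * s%:R :> R by rewrite mulr_ege1// exprn_ege1.
    have h2 : n%:R ^+ 2 * s%:R <= n%:R ^+ 3 * s%:R :> R.
      by rewrite ler_wpM2r ?ler0n// ler_weXn2l.
    by rewrite -natr1 /t natrM natrX natrM exprMn; lra.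
  by field; rewrite gt_eqF.
set D := X - Xhat.
have XhE : Xhat = X - D by rewrite subKr.
(* [X] is itself feasible: its residual is [- xi]. *)
have TVle : TV (X - D) <= TV X.
  by rewrite -XhE; apply: Xmin; rewrite opprD addrA subrr add0r vnorm2N.
have AD : vnorm2 (A D) <= 2 * eps.
  have -> : A D = - (A Xhat - (A X + xi)) + - xi.
    by rewrite /D raddfB opprB [A X + xi - _]addrAC addrK.
  by apply: le_trans (ler_vnorm2D _ _) _; rewrite !vnorm2N; lra.
rewrite l1norm_sparse_residual; set sigma := \sum_(i | _) _.
have cone := TV_cone T TVle; rewrite -/sigma in cone.
have ss : 0 < Num.sqrt s%:R :> R by rewrite sqrtr_gt0 ltr0n.
have DT : \sum_(i in T) cabs (grad D i) <= Num.sqrt s%:R * (3 * mnorm2 D).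
  apply: le_trans (l1_le_sqrt_card_l2 _ _) _.
  apply: ler_pM; rewrite ?sqrtr_ge0 ?l2norm_ge0 ?l2norm_grad_le//.
  by rewrite ler_sqrt ?ler0n// ler_nat Ts geq_minl.
have sob := strong_sobolev n0 t0 t_le d3 rip D.
have st : Num.sqrt t%:R = 432 * n%:R * Num.sqrt s%:R :> R.
  by rewrite natrM sqrtrM ?ler0n// natrX sqrtr_sqr ger0_norm ?ler0n// natrM.
have nR : 0 < n%:R :> R by rewrite ltr0n.
(* The prefactor is [36 / 432 = 1 / 12] over [sqrt s]; the cone bound
   [6 * sqrt s * mnorm2 D + 2 * sigma] then gives the coefficients [1 / 2] and [1 / 6]. *)
have : 36 * n%:R * TV D / Num.sqrt t%:R <= mnorm2 D / 2 + sigma / Num.sqrt s%:R / 6.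
  rewrite st ler_pdivrMr ?mulr_gt0//.
  have -> : (mnorm2 D / 2 + sigma / Num.sqrt s%:R / 6) * (432 * n%:R * Num.sqrt s%:R) =
    36 * n%:R * (2 * (Num.sqrt s%:R * (3 * mnorm2 D)) + 2 * sigma).
    by field; rewrite gt_eqF.
  by rewrite ler_pM2l ?mulr_gt0//; lra.
have sig0 : 0 <= sigma / Num.sqrt s%:R.
  by rewrite divr_ge0 ?sqrtr_ge0// sumr_ge0// => i _; apply: cabs_ge0.
lra.
Qed.
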